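(* Let $\mathcal{B}$ consist of all subsets $B\subset \{1,\dots,10\}$ with $|B|=4$ except for \[\{1,2,3,4\},\ \{1,2,5,6\},\ \{1,2,7,8\},\ \{1,2,9,10\},\ \{3,4,5,6\},\ \{5,6,7,8\},\ \{7,8,9,10\}.\] Then $\mathcal{B}$ is the collection of bases of a matroid on $\{1,\dots,10\}$, and its basis generating polynomial \[f_{10}(x)=\sum_{B\in\mathcal{B}}\prod_{i\in B}x_i\in\mathbb{R}[x_1,\dots,x_{10}]\] is stable; that is, the rank-four matroid $V_{10}$ with bases $\mathcal{B}$ has the half-plane property. Furthermore, no power of $f_{10}$ has a definite determinantal representation.
   Context: A homogeneous polynomial $f\in\mathbb{R}[x_1,\dots,x_n]$ is called stable if for every $v\in(\mathbb{R}_{>0})^n$ and every $w\in\mathbb{R}^n$, the univariate polynomial $f(tv+w)\in\mathbb{R}[t]$ has only real roots. A matroid on $\{1,\dots,n\}$ has the half-plane property if its basis generating polynomial $\sum_{B\text{ basis}}\prod_{i\in B}x_i$ is stable. A power $f^k$ ($k$ a positive integer) of a polynomial $f\in\mathbb{R}[x_1,\dots,x_n]$ has a definite determinantal representation if $f^k=\det(x_1A_1+\cdots+x_nA_n)$ for some positive semidefinite Hermitian matrices $A_1,\dots,A_n$ of a common size. *)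

(* Defs.v *)
From HB Require Import structures.
From mathcomp Require Import all_boot all_order all_algebra.
From mathcomp Require Import complex.
From mathcomp Require Import Rstruct.
From Stdlib Require Rdefinitions.

Set Implicit Arguments.
Unset Strict Implicit.
Unset Printing Implicit Defensive.

Import Order.TTheory GRing.Theory Num.Theory.
Local Open Scope ring_scope.

Notation RC := (complex Rdefinitions.R).

Definition is_matroid_bases (T : finType) (BB : {set {set T}}) : Prop :=
  BB != set0 /\
  forall B1 B2, B1 \in BB -> B2 \in BB ->
    forall x, x \in B1 :\: B2 ->
      exists2 y, y \in B2 :\: B1 & y |: (B1 :\ x) \in BB.

(* Evaluation of the basis generating polynomial sum_{B in BB} prod_{i in B} x_i
   at a point x with coordinates in an arbitrary commutative ring S
   (S = R for real points, S = {poly R} for the substitution x = t v + w,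
   S = RC for complex evaluation). *)
Definition bgp (n : nat) (S : comNzRingType) (BB : {set {set 'I_n}})
    (x : 'I_n -> S) : S :=
  \sum_(B in BB) \prod_(i in B) x i.

Definition real_rooted (p : {poly Rdefinitions.R}) : Prop :=
  forall z : RC, root (map_poly (real_complex Rdefinitions.R) p) z -> Im z = 0.

Definition bgp_stable (n : nat) (BB : {set {set 'I_n}}) : Prop :=
  forall (v w : 'I_n -> Rdefinitions.R), (forall i, 0 < v i) ->
    real_rooted (bgp BB (fun i => v i *: 'X + (w i)%:P)).

Definition half_plane_property (n : nat) (BB : {set {set 'I_n}}) : Prop :=
  bgp_stable BB.

Definition conjT (m n : nat) (A : 'M[RC]_(m, n)) : 'M[RC]_(n, m) :=
  (map_mx (@conjc _) A)^T.

Definition psd_hermitian (d : nat) (A : 'M[RC]_d) : Prop :=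
  conjT A = A /\ forall u : 'cV[RC]_d, 0 <= (conjT u *m A *m u) 0 0.

Definition has_definite_detrep (n : nat) (BB : {set {set 'I_n}}) (k : nat) : Prop :=
  exists (d : nat) (A : 'I_n -> 'M[RC]_d),
    (forall i, psd_hermitian (A i)) /\
    forall x : 'I_n -> Rdefinitions.R,
      (bgp BB (fun i => real_complex Rdefinitions.R (x i))) ^+ k = \det (\sum_(i < n) real_complex Rdefinitions.R (x i) *: A i).

(* Ground set {1,...,10} is encoded as 'I_10, element i+1 <-> ordinal i. *)
Definition e10 (i : nat) : 'I_10 := inord i.

Definition V10_excluded : {set {set 'I_10}} :=
  [set [set e10 0; e10 1; e10 2; e10 3];
       [set e10 0; e10 1; e10 4; e10 5];
       [set e10 0; e10 1; e10 6; e10 7];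
       [set e10 0; e10 1; e10 8; e10 9];
       [set e10 2; e10 3; e10 4; e10 5];
       [set e10 4; e10 5; e10 6; e10 7];
       [set e10 6; e10 7; e10 8; e10 9]].

Definition V10_bases : {set {set 'I_10}} :=
  [set B : {set 'I_10} | (#|B| == 4)%N && (B \notin V10_excluded)].

(* Main.v *)
(* Group the variables into the five pairs {1,2}, ..., {9,10}.  The basis generating
   polynomial depends only on the sum and the product of each pair, so by the
   Grace-Walsh-Szego coincidence theorem it suffices to prove stability after
   identifying the two variables of each pair.  With x the variable of the first pair
   and e_i the elementary symmetric polynomials of the other variables p, q, r, s,
   the result is
     g = 4 (e_2 x + e_3) (x + e_1) + (pr)^2 + (ps)^2 + (qs)^2,
   and e_2 g = K^2 - D, where 4 K is the derivative of g in x and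
     D = e_2^2 (e_1^2 - e_2) + e_2 ((pq)^2 + (qr)^2 + (rs)^2)
         + (pqr)^2 + (pqs)^2 + (prs)^2 + (qrs)^2.
   On a line with positive direction the zeros of e_2 separate those of K, and the
   sign of g at the three zeros of K is opposite to that of e_2; this gives four real
   zeros.

   If g^k = det (sum_j y_j M_j) with M_j positive semidefinite, then the corank of
   sum_(j in S) M_j is k times the order of vanishing of g (1_S + t 1_(S^c)) at t = 0,
   so the row spaces of the M_j violate Ingleton's inequality unless k = 0. *)
Require Import Defs.
From mathcomp Require Import all_boot all_order all_algebra.
From mathcomp Require Import complex polyrcf.
From mathcomp Require Import Rstruct.
From mathcomp Require Import ring lra zify.
Set Implicit Arguments.
Unset Strict Implicit.
Unset Printing Implicit Defensive.
Import Order.TTheory GRing.Theory Num.Theory.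
Local Open Scope ring_scope.
Local Notation R := Rdefinitions.R.
Local Open Scope complex_scope.
Local Notation Rec := (@complex.Re _).
Local Notation Imc := (@complex.Im _).

(** * The matroid *)

(** The excluded sets as lists of numbers, on which facts about all seven of them are decided by
    computation. *)
Definition V10_lines : seq (seq nat) :=
  [:: [:: 0; 1; 2; 3]; [:: 0; 1; 4; 5]; [:: 0; 1; 6; 7]; [:: 0; 1; 8; 9];
      [:: 2; 3; 4; 5]; [:: 4; 5; 6; 7]; [:: 6; 7; 8; 9]]%N.

Definition e10set (l : seq nat) : {set 'I_10} := [set:: [seq e10 i | i <- l]].

Lemma mem_e10set (l : seq nat) (i : 'I_10) :
  all (gtn 10) l -> (i \in e10set l) = (val i \in l).
Proof.
move=> /allP hl; rewrite inE; apply/mapP/idP => [[j jl ->]|il].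
  by rewrite /= inordK //; apply: hl.
by exists (val i); rewrite // /e10 inord_val.
Qed.

Lemma V10_excludedE : V10_excluded = [set:: [seq e10set l | l <- V10_lines]].
Proof.
rewrite /V10_excluded /e10set /=.
by rewrite !(set_cons, set_nil) !setU0 !setUA.
Qed.

Lemma card_e10set (l : seq nat) : (#|e10set l| <= size l)%N.
Proof. by rewrite cardsE (leq_trans (card_size _)) // size_map. Qed.

Lemma V10_excluded_meet (B C : {set 'I_10}) :
  B \in V10_excluded -> C \in V10_excluded -> B != C -> (#|B :&: C| <= 2)%N.
Proof.
rewrite V10_excludedE !in_set => /mapP[l hl ->] /mapP[m hm ->] neq.
have lt10 : all (all (gtn 10)) V10_lines by [].
have hlm : all2rel
    (fun l m : seq nat => (l == m) || (size [seq i <- l | i \in m] <= 2)%N) V10_lines by [].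
have /orP[/eqP lm|] := allrelP hlm _ _ hl hm; first by rewrite lm eqxx in neq.
have l10 := allP lt10 _ hl; have m10 := allP lt10 _ hm.
apply: leq_trans.
have -> : e10set l :&: e10set m = e10set [seq i <- l | i \in m].
  apply/setP => i; rewrite in_setI !mem_e10set //; first by rewrite mem_filter andbC.
  by apply/allP => j; rewrite mem_filter => /andP[_]; apply: (allP l10).
exact: card_e10set.
Qed.

Lemma e10_inj_in (l : seq nat) : all (gtn 10) l -> {in l &, injective e10}.
Proof.
by move=> /allP l10 i j /l10 hi /l10 hj /(congr1 val) /=; rewrite !inordK.
Qed.

Lemma card_V10_excluded (B : {set 'I_10}) : B \in V10_excluded -> #|B| = 4.
Proof.
rewrite V10_excludedE in_set => /mapP[l hl ->].
have huniq : all (fun l : seq nat => [&& uniq l, all (gtn 10) l & size l == 4]) V10_lines by [].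
have /and3P[ul l10 /eqP <-] := allP huniq _ hl.
rewrite cardsE -(size_map e10); apply/card_uniqP.
by rewrite (map_inj_in_uniq (e10_inj_in l10)).
Qed.

Lemma mem_V10_bases (B : {set 'I_10}) :
  (B \in V10_bases) = (#|B| == 4) && (B \notin V10_excluded).
Proof. by rewrite inE. Qed.

Lemma card_exchange (T : finType) (B : {set T}) (x y : T) :
  x \in B -> y \notin B -> #|y |: (B :\ x)| = #|B|.
Proof. by move=> xB yB; rewrite cardsU1 !inE (negPf yB) andbF (cardsD1 x B) xB. Qed.

(* Two failing exchanges B1 - x + y1, B1 - x + y2 would be distinct excluded
   sets sharing the three elements of B1 - x. *)
Lemma V10_matroid : is_matroid_bases V10_bases.
Proof.
split.
  (* One element from each of four pairs, whereas every excluded set is a union of two pairs. *)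
  apply/set0Pn; exists (e10set [:: 0; 2; 4; 6]%N); rewrite inE V10_excludedE.
  have hN : e10set [:: 0; 2; 4; 6]%N \notin [set:: [seq e10set l | l <- V10_lines]].
    rewrite in_set; apply/mapP => -[l hl /setP eqset].
    have lt10 : all (all (gtn 10)) V10_lines by [].
    have hasN :
      all (fun l : seq nat => has (fun i => i \notin l) [:: 0; 2; 4; 6]%N) V10_lines by [].
    have /hasP[i i4 /negP[]] := allP hasN _ hl.
    have i10 : (i < 10)%N by move: i4; rewrite !inE => /or4P[]/eqP->.
    by have := eqset (e10 i); rewrite !mem_e10set ?(allP lt10 _ hl) //= inordK // i4.
  rewrite hN andbT cardsE; apply/eqP.
  have /card_uniqP -> : uniq [seq e10 i | i <- [:: 0; 2; 4; 6]%N]; last by [].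
  by rewrite (map_inj_in_uniq (@e10_inj_in [:: 0; 2; 4; 6]%N _)).
move=> B1 B2; rewrite !mem_V10_bases => /andP[/eqP c1 n1] /andP[/eqP c2 n2] x.
rewrite in_setD => /andP[x2 x1].
have c21 : (0 < #|B2 :\: B1|)%N.
  have : #|B2 :\: B1| = #|B1 :\: B2|.
    by apply/eqP; rewrite -(eqn_add2l #|B1 :&: B2|) cardsID [B1 :&: B2]setIC cardsID c1 c2.
  by move=> ->; apply/card_gt0P; exists x; rewrite inE x2.
have cB y : y \in B2 :\: B1 -> #|y |: (B1 :\ x)| = 4.
  by rewrite inE => /andP[y1 _]; rewrite card_exchange.
have [/existsP[y /andP[yB yN]]|/existsPn hN] :=
  boolP [exists y, (y \in B2 :\: B1) && (y |: (B1 :\ x) \notin V10_excluded)].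
  by exists y; rewrite // mem_V10_bases cB // yN.
have exc y : y \in B2 :\: B1 -> y |: (B1 :\ x) \in V10_excluded.
  by move=> yB; have := hN y; rewrite yB negbK.
have /card_gt0P[y yB] := c21.
have [y' y'B neq] : exists2 y', y' \in B2 :\: B1 & y' != y.
  (* If [y] were the only element of [B2 :\: B1], the exchange would produce [B2] itself, which is
     not excluded. *)
  have [/subsetP sub|] := boolP (B2 :\: B1 \subset [set y]).
    have eqB : y |: (B1 :\ x) = B2.
      apply/eqP; rewrite eq_sym eqEcard cB // c2 leqnn andbT; apply/subsetP=> z zB2; rewrite !inE.
      have [zB1|zB1] := boolP (z \in B1); last by have := sub z; rewrite !inE zB1 zB2 /= => ->.
      by rewrite andbT (contraNneq _ x2) ?orbT // => <-.
    by have := exc y yB; rewrite eqB (negPf n2).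
  by case/subsetPn=> y' y'B; rewrite inE => neq; exists y'.
have := V10_excluded_meet (exc y yB) (exc y' y'B).
have [_ yB1] := setDP yB; have [_ y'B1] := setDP y'B.
have -> : y |: (B1 :\ x) != y' |: (B1 :\ x).
  by apply/eqP => /setP/(_ y'); rewrite !inE eqxx (negPf neq) (negPf y'B1) andbF.
move/(_ isT); rewrite -setUIl leqNgt => /negP[].
apply: leq_trans (subset_leq_card (subsetUr _ _)).
by have := cardsD1 x B1; rewrite x1 c1 add1n => -[<-].
Qed.

(** * The basis generating polynomial *)

(* [s_i] and [a_i] stand for the sum and the product of the i-th pair of variables. *)
Definition V10_pair (S : comNzRingType) (s1 s2 s3 s4 s5 a1 a2 a3 a4 a5 : S) : S :=
  s1 * s2 * s3 * s4 + s1 * s2 * s3 * s5 + s1 * s2 * s4 * s5 + s1 * s3 * s4 * s5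
  + s2 * s3 * s4 * s5
  + a1 * (s2 * s3 + s2 * s4 + s2 * s5 + s3 * s4 + s3 * s5 + s4 * s5)
  + a2 * (s1 * s3 + s1 * s4 + s1 * s5 + s3 * s4 + s3 * s5 + s4 * s5)
  + a3 * (s1 * s2 + s1 * s4 + s1 * s5 + s2 * s4 + s2 * s5 + s4 * s5)
  + a4 * (s1 * s2 + s1 * s3 + s1 * s5 + s2 * s3 + s2 * s5 + s3 * s5)
  + a5 * (s1 * s2 + s1 * s3 + s1 * s4 + s2 * s3 + s2 * s4 + s3 * s4)
  + a2 * a4 + a2 * a5 + a3 * a5.

(** Expanding the product chooses [x i *: 'X] or 1 for each index, so a subset [B] contributes in
    degree [#|B|]. *)
Lemma sum_card_prod (n k : nat) (S : comNzRingType) (x : 'I_n -> S) :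
  \sum_(B : {set 'I_n} | #|B| == k) \prod_(i in B) x i
  = (\prod_(i < n) (1 + x i *: 'X))`_k.
Proof.
transitivity ((\sum_(B : {set 'I_n}) (\prod_(i in B) x i) *: 'X^#|B|)`_k).
  rewrite coef_sum big_mkcond; apply: eq_bigr => B _.
  by rewrite coefZ coefXn eq_sym; case: eqP; rewrite ?mulr1 ?mulr0.
have -> : \prod_(i < n) (1 + x i *: 'X) =
    \sum_(B in {set 'I_n}) \prod_(i < n) (if i \in B then x i *: 'X else 1).
  by under eq_bigr do rewrite addrC; exact: bigA_distr.
congr ((polyseq _)`_k); apply: eq_big => [B|B _]; first by rewrite inE.
by rewrite -big_mkcond /= scaler_prod prodr_const.
Qed.

(** Peels one quadratic factor off a product, so that [coef4_prod5] reduces to a ring identity. *)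
Lemma coef_mul_pair (S : comNzRingType) (s a : S) (q : {poly S}) :
  let p := (1 + s *: 'X + a *: 'X^2) * q in
  [/\ p`_0 = q`_0, p`_1 = q`_1 + s * q`_0
   & forall n, p`_n.+2 = q`_n.+2 + s * q`_n.+1 + a * q`_n].
Proof.
rewrite /= !mulrDl mul1r -!scalerAl.
by split=> [||n]; rewrite !coefD !coefZ coefXM coefXnM /= ?subn2 ?mulr0 ?addr0.
Qed.

(** The fourth elementary symmetric polynomial of the ten variables, grouped by pairs; the last
    seven products belong to the excluded sets. *)
Lemma coef4_prod5 (S : comNzRingType) (s1 s2 s3 s4 s5 a1 a2 a3 a4 a5 : S) :
  ((1 + s1 *: 'X + a1 *: 'X^2) * ((1 + s2 *: 'X + a2 *: 'X^2) *
   ((1 + s3 *: 'X + a3 *: 'X^2) * ((1 + s4 *: 'X + a4 *: 'X^2) *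
   ((1 + s5 *: 'X + a5 *: 'X^2) * 1)))))`_4 =
  V10_pair s1 s2 s3 s4 s5 a1 a2 a3 a4 a5
  + (a1 * a2 + a1 * a3 + a1 * a4 + a1 * a5 + a2 * a3 + a3 * a4 + a4 * a5).
Proof.
have E0 s a q := (let: And3 h _ _ := @coef_mul_pair S s a q in h).
have E1 s a q := (let: And3 _ h _ := @coef_mul_pair S s a q in h).
have E2 s a q := (let: And3 _ _ h := @coef_mul_pair S s a q in h).
by rewrite /V10_pair !(E0, E1, E2) !coef1 /=; ring.
Qed.

Lemma sum_V10_excluded (S : comNzRingType) (x : 'I_10 -> S) :
  let a i := x (e10 i) * x (e10 i.+1) in
  \sum_(B in V10_excluded) \prod_(i in B) x i =
  a 0%N * a 2%N + a 0%N * a 4%N + a 0%N * a 6%N + a 0%N * a 8%N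
  + a 2%N * a 4%N + a 4%N * a 6%N + a 6%N * a 8%N.
Proof.
move=> a.
have prod4 (l : seq nat) : uniq l -> all (gtn 10) l ->
    \prod_(i in e10set l) x i = \prod_(i <- l) x (e10 i).
  move=> ul l10; rewrite -(big_map e10 xpredT x) big_uniq /=.
    by apply: eq_bigl => i; rewrite in_set.
  by rewrite (map_inj_in_uniq (e10_inj_in l10)).
have lt10 : all (fun l : seq nat => uniq l && all (gtn 10) l) V10_lines by [].
rewrite V10_excludedE.
transitivity (\sum_(B <- [seq e10set l | l <- V10_lines]) \prod_(i in B) x i).
  rewrite big_uniq; first by apply: eq_bigl => B; rewrite in_set.
  rewrite map_inj_in_uniq // => l m hl hm eqlm.
  have /andP[_ l10] := allP lt10 _ hl; have /andP[_ m10] := allP lt10 _ hm.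
  have hlm : all2rel (fun l m : seq nat => all (mem m) l ==> (l == m)) V10_lines by [].
  apply/eqP; apply: (implyP (allrelP hlm _ _ hl hm)); apply/allP => i il.
  have i10 : (i < 10)%N := allP l10 _ il.
  have : e10 i \in e10set m by rewrite -eqlm mem_e10set //= inordK.
  by rewrite mem_e10set //= inordK.
rewrite big_map big_seq (eq_bigr (fun l => \prod_(i <- l) x (e10 i))).
  by rewrite -big_seq /V10_lines !(big_cons, big_nil) /a; ring.
by move=> l hl; have /andP[ul l10] := allP lt10 _ hl; rewrite prod4.
Qed.

Lemma bgp_V10E (S : comNzRingType) (x : 'I_10 -> S) :
  let s i := x (e10 i) + x (e10 i.+1) in let a i := x (e10 i) * x (e10 i.+1) in
  bgp V10_bases x =
  V10_pair (s 0%N) (s 2%N) (s 4%N) (s 6%N) (s 8%N) (a 0%N) (a 2%N) (a 4%N) (a 6%N) (a 8%N).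
Proof.
move=> s a.
have := sum_card_prod 4 x.
have -> : \sum_(B : {set 'I_10} | #|B| == 4) \prod_(i in B) x i =
    bgp V10_bases x + \sum_(B in V10_excluded) \prod_(i in B) x i.
  rewrite (bigID (mem V10_excluded)) /= addrC.
  congr (_ + _); apply: eq_bigl => B; first by rewrite mem_V10_bases.
  by rewrite andb_idl // => /card_V10_excluded ->.
rewrite sum_V10_excluded => /(canRL (addrK _)) ->.
pose F k : {poly S} := 1 + x (e10 k) *: 'X.
have pairE k : F k * F k.+1 = 1 + s k *: 'X + a k *: 'X^2.
  by rewrite /F /s /a -!mul_polyC polyCD polyCM; ring.
rewrite (eq_bigr (F \o val)); last by move=> i _; rewrite /F /= /e10 inord_val.
rewrite !big_ord_recl big_ord0 /=.
have := coef4_prod5 (s 0%N) (s 2%N) (s 4%N) (s 6%N) (s 8%N) (a 0%N) (a 2%N) (a 4%N) (a 6%N) (a 8%N).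
by rewrite -!pairE -!mulrA => ->; rewrite /a; ring.
Qed.

(** * Stability *)

(** Take [r = m + i n] with [n >= 0], so that only [b >= 0] needs an argument. If [n <= b], then
    [n^2 < b1 b2], and the real parts give [m^2 < a1 a2]. Hence [4 m^2 n^2 < 4 a1 a2 b1 b2 <= (a1 b2
    + b1 a2)^2], against the imaginary parts. *)
Lemma sqrt_mul_Im (R : rcfType) (b : R) (u v : R[i]) :
  b < Imc u -> b < Imc v -> exists2 r : R[i], r ^+ 2 = u * v & b < Imc r.
Proof.
move=> bu bv; wlog [r ruv r0] : / exists2 r : R[i], r ^+ 2 = u * v & 0 <= Imc r.
  apply; have [le0|lt0] := lerP 0 (Imc (sqrtc (u * v))).
    by exists (sqrtc (u * v)); rewrite ?sqr_sqrtc.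
  exists (- sqrtc (u * v)); rewrite ?sqrrN ?sqr_sqrtc //.
  by move: lt0; case: (sqrtc _) => m n /=; rewrite oppr_ge0 => /ltW.
exists r => //; have [b0|b0] := ltrP b 0; first exact: lt_le_trans r0.
move: bu bv ruv r0; case: u v r => [a1 b1] [a2 b2] [m n] /= bu bv.
rewrite expr2 => -[eqRe eqIm] n0; rewrite ltNge; apply/negP => nb.
have nn : n * n < b1 * b2 by nra.
have mm : 0 <= m * m by rewrite -expr2 sqr_ge0.
have aa : 0 < a1 * a2 by nra.
have h1 : (n * n) * (m * m) <= (n * n) * (a1 * a2) by apply: ler_wpM2l; nra.
have h2 : (n * n) * (a1 * a2) < (b1 * b2) * (a1 * a2) by rewrite ltr_pM2r.
have h3 : 4 * ((n * n) * (m * m)) = (a1 * b2 + b1 * a2) ^+ 2.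
  by rewrite -eqIm; ring.
have := sqr_ge0 (a1 * b2 - b1 * a2); nra.
Qed.

(* Two-variable case of the Grace-Walsh-Szego coincidence theorem. *)
Lemma biaffine_coincidence (R : rcfType) (a b c : R[i]) :
  (forall y, 0 < Imc y -> a + b * (y + y) + c * (y * y) != 0) ->
  forall y z, 0 < Imc y -> 0 < Imc z -> a + b * (y + z) + c * (y * z) != 0.
Proof.
move=> diag y z y0 z0; apply/eqP => eq0.
have [c0|c0] := eqVneq c 0.
  (* Without the product term only [y + z] matters, so both variables may be moved to the
     midpoint. *)
  pose m : R[i] := ((Rec y + Rec z) / 2) +i* ((Imc y + Imc z) / 2).
  have m2 : m + m = y + z.
    by rewrite /m; case: (y) (z) => [? ?] [? ?] /=; congr Complex; field.
  have /diag/eqP[] : 0 < Imc m by rewrite /=; lra.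
  by rewrite m2 -eq0 c0; ring.
have Im_add (u v : R[i]) : Imc (u + v) = Imc u + Imc v by case: u v => [? ?] [? ?].
(* The form equals [c (y + b/c) (z + b/c)] plus a constant, so both factors may be replaced by a
   square root [r] of their product; [sqrt_mul_Im] keeps [r - b/c] in the upper half-plane. *)
have [||r ruv] := @sqrt_mul_Im _ (Imc (b / c)) (y + b / c) (z + b / c).
- by rewrite Im_add; lra.
- by rewrite Im_add; lra.
move=> br; have /diag/eqP[] : 0 < Imc (r - b / c).
  by move: br; case: (r) (b / c) => [? ?] [? ?] /=; lra.
have -> : a = - (b * (y + z) + c * (y * z)) by apply/eqP; rewrite -addr_eq0 addrA eq0.
transitivity (c * (r ^+ 2 - (y + b / c) * (z + b / c))); last by rewrite ruv subrr mulr0.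
by field.
Qed.

(** * Real zeros of polynomials of degree at most four *)

Section RealRoots.
Variable R : rcfType.
Implicit Types (p q h : {poly R}) (a b c t : R).

(** Unlike [lead_coef], this is compatible with sums and products even when [c] is 0. *)
Definition top_coef p n c := (size p <= n.+1)%N /\ p`_n = c.

Lemma top_coefC c : top_coef c%:P 0 c.
Proof. by split; rewrite ?size_polyC_leq1 ?coefC. Qed.

Lemma top_coef_line a b : top_coef (a *: 'X + b%:P) 1 a.
Proof.
split; last by rewrite coefD coefZ coefX coefC mulr1 addr0.
apply: leq_trans (size_polyD _ _) _.
rewrite geq_max (leq_trans (size_scale_leq _ _)) ?size_polyX //.
exact: leq_trans (size_polyC_leq1 _) _.
Qed.

Lemma top_coefD p q n a b :
  top_coef p n a -> top_coef q n b -> top_coef (p + q) n (a + b).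
Proof.
move=> [sp <-] [sq <-]; split; last by rewrite coefD.
by apply: leq_trans (size_polyD _ _) _; rewrite geq_max sp.
Qed.

Lemma top_coefM p q m n a b :
  top_coef p m a -> top_coef q n b -> top_coef (p * q) (m + n) (a * b).
Proof.
move=> [sp <-] [sq <-]; split.
  apply: leq_trans (size_polyMleq _ _) _.
  by rewrite -ltnS; case: (size p + size q)%N (leq_add sp sq) => //= k; rewrite addSn addnS !ltnS.
have lt_m : (m < (m + n).+1)%N by rewrite ltnS leq_addr.
rewrite coefM (bigD1 (Ordinal lt_m)) //= addKn big1 ?addr0 // => i.
rewrite -val_eqE /= neq_ltn => /orP[im|im].
  rewrite [q`__]nth_default ?mulr0 // (leq_trans sq) // ltn_subRL.
  by rewrite ltn_add2r.
by rewrite nth_default ?mul0r // (leq_trans sp).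
Qed.

Lemma top_coef_size p n c : top_coef p n c -> c != 0 -> size p = n.+1.
Proof.
move=> [sp <-] pn; apply/eqP; rewrite eqn_leq sp ltnNge /=.
by apply: contra pn => /(nth_default 0) ->.
Qed.

Lemma top_coef_lead p n c : top_coef p n c -> c != 0 -> lead_coef p = c.
Proof. by move=> tp c0; rewrite lead_coefE (top_coef_size tp c0); case: tp. Qed.

Lemma root_right p a : 0 < lead_coef p -> p.[a] < 0 -> exists2 r, a < r & root p r.
Proof.
move=> p0 pa; have [M hM] := poly_pinfty_gt_lc p0.
have aM : a <= Num.max a M by rewrite le_max lexx.
have pM : 0 < p.[Num.max a M].
  by apply: lt_le_trans p0 (hM _ _); rewrite le_max lexx orbT.
have [|r] := @poly_ivtoo R p _ _ aM; first by rewrite nmulr_rlt0.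
by rewrite in_itv /= => /andP[ar _]; exists r.
Qed.

Lemma root_left p a :
  0 < (-1) ^+ (size p).-1 * lead_coef p -> p.[a] < 0 -> exists2 r, r < a & root p r.
Proof.
move=> p0 pa; have [||r ar rr] := @root_right (p \Po - 'X) (- a).
- by rewrite lead_coef_comp ?size_polyN ?size_polyX // lead_coefN lead_coefX mulrC.
- by rewrite horner_comp hornerN hornerX opprK.
by exists (- r); [rewrite ltrNl | move: rr; rewrite /root horner_comp hornerN hornerX].
Qed.

Lemma top_coef_factor p n c t : top_coef p n.+1 c -> c != 0 -> root p t ->
  exists2 q, p = q * ('X - t%:P) & top_coef q n c.
Proof.
move=> tp c0 /factor_theorem[q pq]; exists q => //.
have sp := top_coef_size tp c0; have lp := top_coef_lead tp c0.
have q0 : q != 0.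
  by apply/eqP => q0; move: sp; rewrite pq q0 mul0r size_poly0.
have sq : size q = n.+1.
  by move: sp; rewrite pq size_Mmonic ?monicXsubC // size_XsubC addn2 => -[].
have lq : lead_coef q = c by rewrite -lp pq lead_coefM lead_coefXsubC mulr1.
by split; rewrite ?sq // -lq lead_coefE sq.
Qed.

Lemma quadratic_split p c t : top_coef p 2 c -> 0 < c -> p.[t] <= 0 ->
  exists r1 r2, p = c *: (('X - r1%:P) * ('X - r2%:P)).
Proof.
move=> tp c0; have c1 := lt0r_neq0 c0.
rewrite le_eqVlt => pt; have [r rr] : exists r, root p r.
  case/orP: pt => [/eqP pt|pt]; first by exists t; apply/eqP.
  by have [|r _ rr] := root_right _ pt; [rewrite (top_coef_lead tp) | exists r].
have [q pq tq] := top_coef_factor tp c1 rr.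
have qE : q = c *: ('X - (- q`_0 / c)%:P).
  rewrite -[LHS]coefK (top_coef_size tq c1) poly_def !(big_ord_recl, big_ord0) /= expr0 addr0.
  case: tq => _ ->; apply/polyP => -[|[|i]];
    rewrite !(coefD, coefN, coefZ, coefX, coefC, coefXn, coef1) /=; by field.
by exists (- q`_0 / c), r; rewrite pq [in LHS]qE -scalerAl.
Qed.

Lemma cubic_separation p c a b : top_coef p 3 c -> 0 < c -> a < b ->
  0 < p.[a] -> p.[b] < 0 ->
  exists t1 t2 t3, [/\ t1 < a, a < t2, t2 < b, b < t3
                     & [/\ root p t1, root p t2 & root p t3]].
Proof.
move=> tp c0 ab pa pb; have c1 := lt0r_neq0 c0.
have [||t1 t1a r1] := @root_left (- p) a; rewrite ?hornerN ?oppr_lt0 //.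
  by rewrite size_polyN lead_coefN (top_coef_size tp) // (top_coef_lead tp) //= !exprS; lra.
have [|t2] := @poly_ivtoo R p _ _ (ltW ab); first by rewrite pmulr_rlt0.
rewrite in_itv /= => /andP[at2 t2b] r2.
have [|t3 bt3 r3] := root_right _ pb; first by rewrite (top_coef_lead tp).
by exists t1, t2, t3; split=> //; split=> //; rewrite -rootN.
Qed.

(** The signs at [t1] and [t3] give one zero beyond each of them. Their two linear factors have a
    negative product at [t2], so the quadratic cofactor is nonpositive there and splits, possibly
    with a double zero. *)
Lemma quartic_split p c t1 t2 t3 : top_coef p 4 c -> 0 < c -> t1 < t2 -> t2 < t3 ->
  p.[t1] < 0 -> 0 <= p.[t2] -> p.[t3] < 0 ->
  exists r1 r2 r3 r4,
    p = c *: (('X - r1%:P) * ('X - r2%:P) * ('X - r3%:P) * ('X - r4%:P)).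
Proof.
move=> tp c0 t12 t23 p1 p2 p3; have c1 := lt0r_neq0 c0.
have [|a at1 ra] := root_left _ p1.
  by rewrite (top_coef_size tp) // (top_coef_lead tp) //= !exprS; lra.
have [|b bt3 rb] := root_right _ p3; first by rewrite (top_coef_lead tp).
have [q pq tq] := top_coef_factor tp c1 ra.
have rqb : root q b.
  by move: rb; rewrite pq rootM root_XsubC => /orP[//|/eqP ba]; exfalso; lra.
have [h qh th] := top_coef_factor tq c1 rqb.
have [|r1 [r2 hE]] := quadratic_split (t := t2) th c0.
  by move: p2; rewrite pq qh !hornerM !hornerXsubC -mulrA nmulr_lge0 //; nra.
by exists r1, r2, b, a; rewrite pq qh hE -!scalerAl.
Qed.

Lemma norm_i_sub r : 1 <= `|'i - r%:C| :> R[i].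
Proof.
rewrite normc_def -[1]/(1%:C) lecR /= -[X in X <= _]sqrtr1 ler_wsqrtr //.
by rewrite sub0r subr0 sqrrN expr1n lerDr sqr_ge0.
Qed.

(** Each factor has modulus at least 1 at ['i]. Real-rootedness becomes a bound by the leading
    coefficient alone, which can be carried through a limit. *)
Lemma quartic_at_i p c r1 r2 r3 r4 : 0 <= c ->
  p = c *: (('X - r1%:P) * ('X - r2%:P) * ('X - r3%:P) * ('X - r4%:P)) ->
  c%:C <= `|(map_poly (real_complex R) p).['i]|.
Proof.
move=> c0 ->; rewrite linearZ /= !rmorphM /= !rmorphB /= !map_polyX !map_polyC /=.
rewrite !hornerE !normrM ger0_norm ?ler0c // -!mulrA ler_peMr ?ler0c //.
by rewrite !mulr_ege1 ?norm_i_sub.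
Qed.

End RealRoots.

(** * The polynomial with the variables of each pair identified *)

Section Diagonal.
Variable S : comNzRingType.
Implicit Types x p q r s : S.

Definition esym1 p q r s := p + q + r + s.
Definition esym2 p q r s := p * q + p * r + p * s + q * r + q * s + r * s.
Definition esym3 p q r s := p * q * r + p * q * s + p * r * s + q * r * s.

(* [V10_pair] with both variables of each pair identified. *)
Definition V10_diag x p q r s :=
  4%:R * ((esym2 p q r s * x + esym3 p q r s) * (x + esym1 p q r s))
  + (p * r) ^+ 2 + (p * s) ^+ 2 + (q * s) ^+ 2.

Lemma V10_pair_diag x p q r s :
  V10_pair (x + x) (p + p) (q + q) (r + r) (s + s)
    (x * x) (p * p) (q * q) (r * r) (s * s) = V10_diag x p q r s.
Proof. by rewrite /V10_pair /V10_diag /esym1 /esym2 /esym3; ring. Qed.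

(* A quarter of the derivative of [V10_diag] in [x]. *)
Definition V10_dx x p q r s :=
  esym2 p q r s * (x + x + esym1 p q r s) + esym3 p q r s.

Definition V10_disc p q r s :=
  (esym1 p q r s * esym2 p q r s - esym3 p q r s) ^+ 2
  - esym2 p q r s * ((p * r) ^+ 2 + (p * s) ^+ 2 + (q * s) ^+ 2).

Lemma V10_diag_square x p q r s :
  esym2 p q r s * V10_diag x p q r s = V10_dx x p q r s ^+ 2 - V10_disc p q r s.
Proof. by rewrite /V10_diag /V10_dx /V10_disc /esym1 /esym2 /esym3; ring. Qed.

End Diagonal.

Section Morphism.
Variables (S T : comNzRingType) (f : {rmorphism S -> T}).

Lemma rmorph_esym1 p q r s : f (esym1 p q r s) = esym1 (f p) (f q) (f r) (f s).
Proof. by rewrite /esym1 !rmorphD. Qed.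

Lemma rmorph_esym2 p q r s : f (esym2 p q r s) = esym2 (f p) (f q) (f r) (f s).
Proof. by rewrite /esym2 !(rmorphD, rmorphM). Qed.

Lemma rmorph_esym3 p q r s : f (esym3 p q r s) = esym3 (f p) (f q) (f r) (f s).
Proof. by rewrite /esym3 !(rmorphD, rmorphM). Qed.

Lemma rmorph_V10_dx x p q r s :
  f (V10_dx x p q r s) = V10_dx (f x) (f p) (f q) (f r) (f s).
Proof.
by rewrite /V10_dx /esym1 /esym2 /esym3 !(rmorphD, rmorphM).
Qed.

Lemma rmorph_V10_diag x p q r s :
  f (V10_diag x p q r s) = V10_diag (f x) (f p) (f q) (f r) (f s).
Proof.
by rewrite /V10_diag /esym1 /esym2 /esym3 !(rmorphD, rmorphXn, rmorphM, rmorph1).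
Qed.

End Morphism.

(** * Real zeros of the diagonal polynomial on lines of positive direction *)

Section RealDiagonal.
Variable R : rcfType.
Implicit Types p q r s a b c d t : R.

Lemma V10_disc_gt0 p q r s : 0 < esym2 p q r s -> 0 < V10_disc p q r s.
Proof.
move=> e20; have -> : V10_disc p q r s =
    esym2 p q r s ^+ 2 * (esym1 p q r s ^+ 2 - esym2 p q r s)
    + esym2 p q r s * ((p * q) ^+ 2 + (q * r) ^+ 2 + (r * s) ^+ 2)
    + ((p * q * r) ^+ 2 + (p * q * s) ^+ 2 + (p * r * s) ^+ 2 + (q * r * s) ^+ 2).
  by rewrite /V10_disc /esym1 /esym2 /esym3; ring.
have e12 : 0 < esym1 p q r s ^+ 2 - esym2 p q r s.
  have -> : esym1 p q r s ^+ 2 - esym2 p q r s = p ^+ 2 + q ^+ 2 + r ^+ 2 + s ^+ 2 + esym2 p q r s.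
    by rewrite /esym1 /esym2; ring.
  by rewrite ltr_wpDl // !addr_ge0 ?sqr_ge0.
rewrite -addrA ltr_pwDl //; first by rewrite mulr_gt0 ?exprn_gt0.
by rewrite addr_ge0 ?mulr_ge0 ?(ltW e20) // !addr_ge0 ?sqr_ge0.
Qed.

Lemma V10_disc_ge0 p q r s : esym2 p q r s <= 0 -> 0 <= V10_disc p q r s.
Proof.
move=> e20; rewrite /V10_disc subr_ge0 (le_trans _ (sqr_ge0 _)) //.
by rewrite mulr_le0_ge0 // !addr_ge0 ?sqr_ge0.
Qed.

(** An identity expresses [-2 e_1 e_3] as a sum of squares and products of squares minus [e_2^2]. *)
Lemma esym13_lt0 p q r s : esym2 p q r s = 0 ->
  0 < p ^+ 2 + q ^+ 2 -> 0 < r ^+ 2 + s ^+ 2 -> esym1 p q r s * esym3 p q r s < 0.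
Proof.
move=> e20 pq rs; rewrite -oppr_gt0 -(pmulr_rgt0 _ (ltr0n _ 2)).
have -> : 2%:R * - (esym1 p q r s * esym3 p q r s) =
   (p * q - r * s) ^+ 2 + (p ^+ 2 + q ^+ 2) * (r ^+ 2 + s ^+ 2) - esym2 p q r s ^+ 2.
  by rewrite /esym1 /esym2 /esym3; ring.
by rewrite e20 expr0n subr0 ltr_wpDl ?sqr_ge0 ?mulr_gt0.
Qed.

(** Nonproportional affine functions have no common zero; this supplies the hypotheses of
    [esym13_lt0] along a generic line. *)
Lemma sqr_pair_gt0 a b c d t : a * d != c * b -> 0 < (a * t + b) ^+ 2 + (c * t + d) ^+ 2.
Proof.
move=> ne; rewrite lt0r addr_ge0 ?sqr_ge0 // andbT; apply: contra ne.
rewrite paddr_eq0 ?sqr_ge0 // !sqrf_eq0 !addr_eq0 => /andP[/eqP ab /eqP cd].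
by rewrite -[b]opprK -[d]opprK -ab -cd; apply/eqP; ring.
Qed.

Section Line.
Variables vx vp vq vr vs wx wp wq wr ws : R.
Hypotheses (vx0 : 0 < vx) (vp0 : 0 < vp) (vq0 : 0 < vq) (vr0 : 0 < vr) (vs0 : 0 < vs).
Hypotheses (gpq : vp * wq != vq * wp) (grs : vr * ws != vs * wr).

Let L v w : {poly R} := v *: 'X + w%:P.
Let x t := vx * t + wx.
Let p t := vp * t + wp.
Let q t := vq * t + wq.
Let r t := vr * t + wr.
Let s t := vs * t + ws.

Let L_eval v w t : (L v w).[t] = v * t + w.
Proof. by rewrite /L hornerD hornerZ hornerX hornerC. Qed.

Let Lx := L vx wx. Let Lp := L vp wp. Let Lq := L vq wq. Let Lr := L vr wr. Let Ls := L vs ws.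

Let E1 := esym1 Lp Lq Lr Ls.
Let E2 := esym2 Lp Lq Lr Ls.
Let E3 := esym3 Lp Lq Lr Ls.
Let Kp := V10_dx Lx Lp Lq Lr Ls.
Let Gp := V10_diag Lx Lp Lq Lr Ls.

Let evalE t : [/\ E1.[t] = esym1 (p t) (q t) (r t) (s t), E2.[t] = esym2 (p t) (q t) (r t) (s t),
   E3.[t] = esym3 (p t) (q t) (r t) (s t), Kp.[t] = V10_dx (x t) (p t) (q t) (r t) (s t) &
   Gp.[t] = V10_diag (x t) (p t) (q t) (r t) (s t)].
Proof.
rewrite -!/(horner_eval t _) /E1 /E2 /E3 /Kp /Gp.
rewrite rmorph_esym1 rmorph_esym2 rmorph_esym3 rmorph_V10_dx rmorph_V10_diag.
by rewrite /= /horner_eval /Lx /Lp /Lq /Lr /Ls !L_eval.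
Qed.

Let topL v w : top_coef (L v w) 1 v := top_coef_line v w.

Let topE1 : top_coef E1 1 (esym1 vp vq vr vs).
Proof. by rewrite /E1 /esym1; do ?apply: top_coefD; exact: topL. Qed.

Let topE2 : top_coef E2 2 (esym2 vp vq vr vs).
Proof.
by rewrite /E2 /esym2; do ?apply: top_coefD; apply: (@top_coefM _ _ _ 1 1); exact: topL.
Qed.

Let topE3 : top_coef E3 3 (esym3 vp vq vr vs).
Proof.
rewrite /E3 /esym3; do ?apply: top_coefD; apply: (@top_coefM _ _ _ 2 1);
  first [apply: (@top_coefM _ _ _ 1 1) | idtac]; exact: topL.
Qed.

Let topK : top_coef Kp 3 (V10_dx vx vp vq vr vs).
Proof.
rewrite /Kp /V10_dx; apply: top_coefD; last exact: topE3.
apply: (@top_coefM _ _ _ 2 1); first exact: topE2.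
by apply: top_coefD; [apply: top_coefD; exact: topL | exact: topE1].
Qed.

Let topG : top_coef Gp 4 (V10_diag vx vp vq vr vs).
Proof.
have topsq a b c d : top_coef ((L a b * L c d) ^+ 2) 4 ((a * c) ^+ 2).
  by rewrite !expr2; apply: (@top_coefM _ _ _ 2 2); apply: (@top_coefM _ _ _ 1 1); exact: topL.
rewrite /Gp /V10_diag; apply: top_coefD; last exact: topsq.
apply: top_coefD; last exact: topsq.
apply: top_coefD; last exact: topsq.
rewrite -[4%:R in X in top_coef X]polyC_natr.
apply: (@top_coefM _ _ _ 0 4); first exact: top_coefC.
apply: (@top_coefM _ _ _ 3 1); last by apply: top_coefD; [exact: topL | exact: topE1].
by apply: top_coefD; [apply: (@top_coefM _ _ _ 2 1); [exact: topE2 | exact: topL] | exact: topE3].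
Qed.

Let e1v : 0 < esym1 vp vq vr vs.
Proof. by rewrite /esym1 !addr_gt0. Qed.
Let e2v : 0 < esym2 vp vq vr vs.
Proof. by rewrite /esym2 !addr_gt0 // mulr_gt0. Qed.
Let e3v : 0 < esym3 vp vq vr vs.
Proof. by rewrite /esym3 !addr_gt0 // !mulr_gt0. Qed.
Let kv : 0 < V10_dx vx vp vq vr vs.
Proof. by rewrite /V10_dx !(addr_gt0, mulr_gt0). Qed.
Let gv : 0 < V10_diag vx vp vq vr vs.
Proof. by rewrite /V10_diag !(addr_gt0, mulr_gt0, exprn_gt0) // ltr0n. Qed.

(* The line [t |-> t v + w] meets [esym2 = 0] in two points, on opposite sides of
   [esym1 = 0]; by [gpq], [grs] and [esym13_lt0], [esym3], and with it [V10_dx],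
   changes sign between them. *)
Lemma V10_diag_line_bound :
  (V10_diag vx vp vq vr vs)%:C <= `|(map_poly (real_complex R) Gp).['i]|.
Proof.
pose t0 := - (wp + wq + wr + ws) / (vp + vq + vr + vs).
have e1t0 : E1.[t0] = 0.
  have [-> _ _ _ _] := evalE t0; rewrite /esym1 /p /q /r /s /t0.
  by field; apply: lt0r_neq0.
have e1E t : E1.[t] = esym1 vp vq vr vs * (t - t0).
  rewrite -[LHS]subr0 -e1t0; have [-> _ _ _ _] := evalE t; have [-> _ _ _ _] := evalE t0.
  by rewrite /esym1 /p /q /r /s; ring.
have pq t := sqr_pair_gt0 t gpq; have rs t := sqr_pair_gt0 t grs.
(* Where [e_1] vanishes, [2 e_2] is minus the sum of the four squares; hence [E2] has a zero on each
   side of [t0]. *)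
have e2t0 : E2.[t0] < 0.
  have [e1 e2 _ _ _] := evalE t0.
  have : 2%:R * E2.[t0] = E1.[t0] ^+ 2 - (p t0 ^+ 2 + q t0 ^+ 2) - (r t0 ^+ 2 + s t0 ^+ 2).
    by rewrite e1 e2 /esym1 /esym2; ring.
  by rewrite e1t0; have := pq t0; have := rs t0; rewrite -/(p t0) -/(q t0) -/(r t0) -/(s t0); lra.
have e2v0 := lt0r_neq0 e2v.
have [|a1 a1t0 ra1] := root_left _ e2t0.
  by rewrite (top_coef_size topE2) //= sqrrN expr1n mul1r (top_coef_lead topE2).
have [|a2 a2t0 ra2] := root_right _ e2t0; first by rewrite (top_coef_lead topE2).
have e2E t : E2.[t] = esym2 vp vq vr vs * ((t - a1) * (t - a2)).
  have [h hE th] := top_coef_factor topE2 e2v0 ra1.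
  have rh : root h a2.
    by move: ra2; rewrite hE rootM root_XsubC => /orP[//|/eqP a21]; exfalso; lra.
  have [k kE [sk <-]] := top_coef_factor th e2v0 rh.
  rewrite hE kE !hornerM !hornerXsubC (size1_polyC sk) !hornerC coefC /=; ring.
have sgn a : root E2 a -> E1.[a] * Kp.[a] < 0.
  move=> /rootP; have [-> -> _ -> _] := evalE a => e20.
  by rewrite /V10_dx e20 mul0r add0r esym13_lt0 // ?pq ?rs.
have K1 : 0 < Kp.[a1].
  by have := sgn a1 ra1; rewrite e1E nmulr_rlt0 // pmulr_rlt0 // subr_lt0.
have K2 : Kp.[a2] < 0.
  by have := sgn a2 ra2; rewrite e1E pmulr_rlt0 // mulr_gt0 // subr_gt0.
have [|t1 [t2 [t3 [t1a at2 t2a at3 [r1 r2 r3]]]]] := cubic_separation topK kv _ K1 K2.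
  exact: lt_trans a1t0 a2t0.
have KG t : root Kp t -> E2.[t] * Gp.[t] = - V10_disc (p t) (q t) (r t) (s t).
  move=> /rootP; have [_ -> _ -> ->] := evalE t => k0.
  by rewrite V10_diag_square k0 expr0n sub0r.
have Gneg t : root Kp t -> 0 < E2.[t] -> Gp.[t] < 0.
  move=> rt e20; rewrite -(pmulr_rlt0 _ e20) KG // oppr_lt0.
  by apply: V10_disc_gt0; have [_ <- _ _ _] := evalE t.
have Gpos t : root Kp t -> E2.[t] < 0 -> 0 <= Gp.[t].
  move=> rt e20; rewrite -(nmulr_rle0 _ e20) KG // oppr_le0.
  by apply: V10_disc_ge0; have [_ <- _ _ _] := evalE t; apply: ltW.
(* [E2] is positive at the outer zeros [t1], [t3] of [Kp] and negative at the middle one [t2]. *)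
have [||||| b1 [b2 [b3 [b4 GE]]]] := @quartic_split _ _ _ t1 t2 t3 topG gv.
- exact: lt_trans t1a at2.
- exact: lt_trans t2a at3.
- by apply: Gneg => //; rewrite e2E pmulr_rgt0 // nmulr_rgt0; lra.
- by apply: Gpos => //; rewrite e2E pmulr_rlt0 // pmulr_rlt0; lra.
- by apply: Gneg => //; rewrite e2E pmulr_rgt0 // pmulr_rgt0; lra.
exact: quartic_at_i (ltW gv) GE.
Qed.

End Line.
End RealDiagonal.

(** * Nonvanishing on the product of upper half-planes *)

Section UpperHalfPlane.
Variable R : rcfType.

(** A complex point is the value at [t = i] of the real line with direction its imaginary part and
    offset its real part. *)
Lemma V10_diag_bound (x p q r s : R[i]) :
  0 < Imc x -> 0 < Imc p -> 0 < Imc q -> 0 < Imc r -> 0 < Imc s ->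
  Imc p * Rec q != Imc q * Rec p -> Imc r * Rec s != Imc s * Rec r ->
  (V10_diag (Imc x) (Imc p) (Imc q) (Imc r) (Imc s))%:C <= `|V10_diag x p q r s|.
Proof.
move=> x0 p0 q0 r0 s0 gpq grs.
have := V10_diag_line_bound (Rec x) x0 p0 q0 r0 s0 gpq grs.
rewrite -/(horner_eval 'i _) !rmorph_V10_diag /= /horner_eval.
have E (y : R[i]) : (map_poly (real_complex R) (Imc y *: 'X + (Rec y)%:P)).['i] = y.
  rewrite rmorphD /= linearZ /= map_polyX map_polyC !hornerE /=.
  by rewrite addrC mulrC -complexE.
by rewrite !E.
Qed.

(** Two forbidden values cannot exhaust [d], [d / 2] and [d / 3]. *)
Lemma avoid_two (d b c : R) : 0 < d -> exists2 e, 0 < e <= d & (e != b) && (e != c).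
Proof.
move=> d0.
have [/andP h|h1] := boolP ((d != b) && (d != c)).
  by exists d; rewrite ?d0 ?lexx //; apply/andP.
have [/andP h|h2] := boolP ((d / 2 != b) && (d / 2 != c)).
  by exists (d / 2); [apply/andP; split; lra | apply/andP].
exists (d / 3); first by apply/andP; split; lra.
by move: h1 h2; rewrite !negb_and !negbK => /orP[]/eqP h1 /orP[]/eqP h2;
  apply/andP; split; apply/eqP => h3; lra.
Qed.

(* The bound of [V10_diag_bound] does not depend on the real parts, so it survives the
   limit [e -> 0] of the perturbation [q + e], [s + e], which makes the point generic. *)
Lemma V10_diag_neq0 (x p q r s : R[i]) :
  0 < Imc x -> 0 < Imc p -> 0 < Imc q -> 0 < Imc r -> 0 < Imc s ->
  V10_diag x p q r s != 0.
Proof.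
move=> x0 p0 q0 r0 s0; apply/negP => /eqP eq0.
(* The perturbation as a polynomial in [e]: a zero at 0 would give [|P(e)| <= u e] for [0 < e <= 1],
   against the constant lower bound [l]. *)
pose P : {poly R[i]} := V10_diag x%:P p%:P (q%:P + 'X) r%:P (s%:P + 'X).
have PE e : P.[e] = V10_diag x p (q + e) r (s + e).
  by rewrite -/(horner_eval e P) rmorph_V10_diag /= /horner_eval !hornerE.
have : root P 0 by rewrite /root PE !addr0 eq0.
case/factor_theorem => Q; rewrite subr0 => PQ.
have [ub hub] := poly_disk_bound Q 1.
have ub0 : 0 <= ub by apply: le_trans (hub 0 _); rewrite ?normr0 ?ler01.
have [u uE] : exists u, ub = u%:C.
  by exists (Rec ub); rewrite [LHS]complexE (ger0_Im ub0) mulr0 addr0.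
have u0 : 0 <= u by rewrite -ler0c -uE.
pose l := V10_diag (Imc x) (Imc p) (Imc q) (Imc r) (Imc s).
have l0 : 0 < l.
  rewrite /l /V10_diag /esym1 /esym2 /esym3.
  by rewrite !(addr_gt0, mulr_gt0, exprn_gt0) // ltr0n.
have bound e : 0 < e -> e <= 1 -> Imc p * (Rec q + e) != Imc q * Rec p ->
    Imc r * (Rec s + e) != Imc s * Rec r -> l <= u * e.
  move=> e0 e1 gpq grs; rewrite -lecR rmorphM /= -uE.
  have ReD (y : R[i]) : Rec (y + e%:C) = Rec y + e by case: y.
  have ImD (y : R[i]) : Imc (y + e%:C) = Imc y by case: y => ? ? /=; rewrite addr0.
  apply: (@le_trans _ _ `|P.[e%:C]|).
    by rewrite PE /l -[Imc q](ImD q) -[Imc s](ImD s); apply: V10_diag_bound; rewrite ?ReD ?ImD.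
  rewrite PQ hornerM hornerX normrM (ger0_norm (x := e%:C)) ?ler0c ?(ltW e0) //.
  rewrite ler_wpM2r ?ler0c ?(ltW e0) // hub // ger0_norm ?ler0c ?(ltW e0) //.
  by rewrite -[1]/(1%:C) lecR.
(* Chosen so that [0 < e <= d] gives [u e < (u + 1) e <= l]. *)
pose d := Num.min 1 (l / (u + 1)).
have d0 : 0 < d by rewrite lt_min ltr01 divr_gt0 // ltr_wpDl.
(* The two avoided values are those at which the genericity conditions fail. *)
have [e /andP[e0 ed] /andP[eb ec]] :=
  avoid_two (Imc q * Rec p / Imc p - Rec q) (Imc s * Rec r / Imc r - Rec s) d0.
move: ed; rewrite le_min => /andP[e1 el].
have : l <= u * e.
  apply: bound => //.
    by apply: contra eb => /eqP <-; apply/eqP; field; apply: lt0r_neq0.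
  by apply: contra ec => /eqP <-; apply/eqP; field; apply: lt0r_neq0.
rewrite leNgt => /negP[]; have u1 : 0 < u + 1 by rewrite ltr_wpDl.
move: el; rewrite ler_pdivlMr // => el.
by apply: lt_le_trans el; rewrite mulrDr mulr1 [e * u]mulrC ltrDl.
Qed.

(** Affinity in the sum and product of a pair is phrased through values of [F], so that [ring]
    verifies it without naming coefficients. *)
Lemma biaffine_pair (F : R[i] -> R[i] -> R[i]) :
  (forall s a, F s a = F 0 0 + (F 1 0 - F 0 0) * s + (F 0 1 - F 0 0) * a) ->
  (forall y, 0 < Imc y -> F (y + y) (y * y) != 0) ->
  forall y z, 0 < Imc y -> 0 < Imc z -> F (y + z) (y * z) != 0.
Proof.
move=> FE Fdiag y z y0 z0; rewrite FE; apply: biaffine_coincidence => // t t0.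
by rewrite -FE Fdiag.
Qed.

(** The coincidence theorem is applied to one pair at a time; after five applications only
    [V10_diag] remains. *)
Lemma V10_pair_neq0 (y1 y2 y3 y4 y5 z1 z2 z3 z4 z5 : R[i]) :
  0 < Imc y1 -> 0 < Imc y2 -> 0 < Imc y3 -> 0 < Imc y4 -> 0 < Imc y5 ->
  0 < Imc z1 -> 0 < Imc z2 -> 0 < Imc z3 -> 0 < Imc z4 -> 0 < Imc z5 ->
  V10_pair (y1 + z1) (y2 + z2) (y3 + z3) (y4 + z4) (y5 + z5)
    (y1 * z1) (y2 * z2) (y3 * z3) (y4 * z4) (y5 * z5) != 0.
Proof.
move=> y10 y20 y30 y40 y50 z10 z20 z30 z40 z50.
apply: (@biaffine_pair (fun s a => V10_pair s _ _ _ _ a _ _ _ _)) y10 z10.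
  by move=> s a; rewrite /V10_pair; ring.
move=> x x0.
apply: (@biaffine_pair (fun s a => V10_pair _ s _ _ _ _ a _ _ _)) y20 z20.
  by move=> s a; rewrite /V10_pair; ring.
move=> p p0.
apply: (@biaffine_pair (fun s a => V10_pair _ _ s _ _ _ _ a _ _)) y30 z30.
  by move=> s a; rewrite /V10_pair; ring.
move=> q q0.
apply: (@biaffine_pair (fun s a => V10_pair _ _ _ s _ _ _ _ a _)) y40 z40.
  by move=> s a; rewrite /V10_pair; ring.
move=> r r0.
apply: (@biaffine_pair (fun s a => V10_pair _ _ _ _ s _ _ _ _ a)) y50 z50.
  by move=> s a; rewrite /V10_pair; ring.
by move=> s s0; rewrite V10_pair_diag V10_diag_neq0.
Qed.

End UpperHalfPlane.

Lemma rmorph_bgp (n : nat) (S T : comNzRingType) (f : {rmorphism S -> T})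
    (BB : {set {set 'I_n}}) (x : 'I_n -> S) :
  f (bgp BB x) = bgp BB (fun i => f (x i)).
Proof. by rewrite /bgp rmorph_sum; apply: eq_bigr => B _; rewrite rmorph_prod. Qed.

(** A zero [y] in the upper half-plane would make the polynomial vanish at [v y + w], whose
    coordinates all lie there; a zero in the lower half-plane is reflected by conjugation, since [p]
    is real. *)
Lemma V10_stable : half_plane_property V10_bases.
Proof.
move=> v w v0 z; set p := bgp _ _.
have upper y : root (map_poly (real_complex R) p) y -> ~ 0 < Imc y.
  move=> /rootP; rewrite -/(horner_eval y _) /p !rmorph_bgp bgp_V10E => /eqP p0 y0.
  apply/negP: p0.
  have h i : 0 < Imc (horner_eval y (map_poly (real_complex R) (v i *: 'X + (w i)%:P))).
    rewrite /horner_eval rmorphD /= linearZ /= map_polyX map_polyC !hornerE /=.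
    by case: (y) y0 => a b /= b0; rewrite mul0r !addr0 mulr_gt0.
  by apply: V10_pair_neq0; exact: h.
move=> rz; rewrite -complexIm; have [lt0|gt0|->//] := ltrgtP (Imc z) 0.
  have /upper[] : root (map_poly (real_complex R) p) (z^*).
    rewrite -complex_root_conj -map_poly_comp.
    by rewrite (eq_map_poly (g := real_complex R)) // => a /=; rewrite oppr0.
  by case: (z) lt0 => a b /=; rewrite oppr_gt0.
by case: (upper z rz).
Qed.

(** * Determinantal representations *)

Section Hermitian.
Implicit Types (m n d : nat).

Lemma conjTE m n (A : 'M[RC]_(m, n)) : conjT A = map_mx Num.conj A^T.
Proof. by rewrite /conjT map_trmx. Qed.

Lemma conjTM m n d (A : 'M[RC]_(m, n)) (B : 'M[RC]_(n, d)) :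
  conjT (A *m B) = conjT B *m conjT A.
Proof. by rewrite /conjT map_mxM trmx_mul. Qed.

Lemma conjTD m n (A B : 'M[RC]_(m, n)) : conjT (A + B) = conjT A + conjT B.
Proof. by rewrite /conjT map_mxD linearD. Qed.

Lemma conjTK m n (A : 'M[RC]_(m, n)) : conjT (conjT A) = A.
Proof. by apply/matrixP => i j; rewrite !mxE conjcK. Qed.

Lemma hermitian_diag d (A : 'M[RC]_d) : conjT A = A ->
  exists (P : 'M[RC]_d) (sp : 'rV[RC]_d),
    P *m conjT P = 1%:M /\ A = conjT P *m diag_mx sp *m P.
Proof.
move=> hA; have /hermitian_normalmx/orthomx_spectralP AE : A \is hermsymmx.
  by apply/is_hermitianmxP; rewrite expr0 scale1r -conjTE hA.
have uP := spectral_unitarymx A.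
exists (spectralmx A), (spectral_diag A); split; first by rewrite conjTE; apply/unitarymxP.
by rewrite conjTE -invmx_unitary.
Qed.

Lemma psd_gram d (A : 'M[RC]_d) : psd_hermitian A -> exists B : 'M[RC]_d, A = conjT B *m B.
Proof.
move=> [hA Age0]; have [P [sp [PP AE]]] := hermitian_diag hA.
have sp0 i : 0 <= sp 0 i.
  (* Testing on the i-th eigenvector isolates the eigenvalue [sp 0 i]. *)
  have := Age0 (conjT (row i P)); rewrite conjTK.
  have -> : row i P *m A *m conjT (row i P) = row i (diag_mx sp) *m conjT (delta_mx 0 i).
    rewrite (rowE i P) AE conjTM.
    rewrite -!mulmxA [P *m (conjT P *m _)]mulmxA PP mul1mx.
    by rewrite [P *m (conjT P *m _)]mulmxA PP mul1mx mulmxA -rowE.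
  rewrite row_diag_mx -scalemxAl !mxE (bigD1 i) //= big1 => [|j ji].
    by rewrite !mxE !eqxx conjc1 addr0 !mulr1.
  by rewrite !mxE (negPf ji) andbF mul0r.
exists (diag_mx (map_mx sqrtC sp) *m P).
rewrite conjTM AE !mulmxA; congr (_ *m _); rewrite -!mulmxA; congr (_ *m _).
have -> : conjT (diag_mx (map_mx sqrtC sp)) = diag_mx (map_mx sqrtC sp).
  rewrite conjTE tr_diag_mx map_diag_mx; congr diag_mx; apply/rowP => i; rewrite !mxE.
  by apply/CrealP; rewrite ger0_real // sqrtC_ge0.
by rewrite mulmx_diag; congr diag_mx; apply/rowP => i; rewrite !mxE -expr2 sqrtCK.
Qed.

Lemma gram_sum_eq0 m n d (A : 'M[RC]_(m, d)) (B : 'M[RC]_(n, d)) :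
  conjT A *m A + conjT B *m B = 0 -> A = 0.
Proof.
move=> AB0; apply/matrixP => i j; rewrite mxE.
have ge0 k (C : 'M[RC]_(k, d)) l : 0 <= conjT C j l * C l j.
  by rewrite !mxE mulrC mulcJ_ge0.
have /matrixP/(_ j j) := AB0; rewrite !mxE => /eqP.
rewrite paddr_eq0 ?sumr_ge0 // => /andP[+ _].
rewrite psumr_eq0 // => /allP/(_ i); rewrite mem_index_enum !mxE => /(_ isT).
by rewrite mulf_eq0 conjc_eq0 orbb => /eqP.
Qed.

Lemma psd_add d (A B : 'M[RC]_d) : psd_hermitian A -> psd_hermitian B -> psd_hermitian (A + B).
Proof.
move=> [hA A0] [hB B0]; split=> [|u]; first by rewrite conjTD hA hB.
by rewrite mulmxDr mulmxDl mxE addr_ge0.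
Qed.

Lemma psd0 d : psd_hermitian (0 : 'M[RC]_d).
Proof.
split=> [|u]; first by apply/matrixP => i j; rewrite !mxE conjc0.
by rewrite mulmx0 mul0mx mxE.
Qed.

(** If [A + B] kills [K], then the Gram matrices of [F K] and [G K] sum to 0, so [F K = 0] and [A]
    kills [K] too. *)
Lemma psd_addr_sub d (A B : 'M[RC]_d) : psd_hermitian A -> psd_hermitian B ->
  (A <= (A + B)%R)%MS.
Proof.
move=> /psd_gram[F AE] /psd_gram[G BE]; rewrite submxE.
set K := cokermx _; have K0 : (A + B) *m K = 0 by rewrite mulmx_coker.
rewrite AE -mulmxA (_ : F *m K = 0) ?mulmx0 //.
apply: (@gram_sum_eq0 _ _ _ _ (G *m K)).
have gramE (X : 'M[RC]_d) : conjT (X *m K) *m (X *m K) = conjT K *m (conjT X *m X *m K).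
  by rewrite conjTM !mulmxA.
by rewrite !gramE -AE -BE -mulmxDr -mulmxDl K0 mulmx0.
Qed.

(** Ranks of partial sums thereby become dimensions of sums of row spaces, to which Ingleton's
    inequality applies. *)
Lemma psd_adds_sub d (A B : 'M[RC]_d) : psd_hermitian A -> psd_hermitian B ->
  (A + B :=: (A + B)%R)%MS.
Proof.
move=> pA pB; apply/eqmxP; rewrite addsmx_sub psd_addr_sub //=.
by rewrite [X in (_ <= X)%MS]addrC psd_addr_sub //= addmx_sub_adds.
Qed.

Lemma mxrank_diag_le (F : fieldType) d (v : 'rV[F]_d) :
  (\rank (diag_mx v) <= #|[pred i | v 0%R i != 0%R]|)%N.
Proof.
have -> : diag_mx v = \sum_(i | v 0 i != 0) v 0 i *: delta_mx i i.
  rewrite diag_mx_sum_delta (bigID (fun i => v 0 i == 0)) /= big1 ?add0r // => i /eqP ->.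
  by rewrite scale0r.
rewrite -sum1_card.
elim/big_ind2: _ => [|A a B b hA hB|i _]; first by rewrite mxrank0.
  exact: leq_trans (mxrank_add _ _) (leq_add hA hB).
by rewrite (leq_trans (mxrank_scale _ _)) // mxrank_delta.
Qed.

Lemma mxrank_diag (F : fieldType) d (v : 'rV[F]_d) :
  \rank (diag_mx v) = #|[pred i | v 0%R i != 0%R]|.
Proof.
apply/eqP; rewrite eqn_leq mxrank_diag_le /=.
(* The indicator of the zero entries completes [v] to an invertible diagonal matrix, which bounds
   the rank from below. *)
pose w : 'rV[F]_d := \row_i (v 0 i == 0)%:R.
have rw : (\rank (diag_mx w) <= #|[predC [pred i | v 0%R i != 0%R]]|)%N.
  apply: leq_trans (mxrank_diag_le _) _; apply: subset_leq_card; apply/subsetP => i.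
  by rewrite !inE mxE; case: (v 0 i == 0); rewrite ?eqxx.
rewrite -(leq_add2r #|[predC [pred i | v 0%R i != 0%R]]|) cardC card_ord.
rewrite (leq_trans _ (leq_add (leqnn _) rw)) // (leq_trans _ (mxrank_add _ _)) //.
rewrite -linearD /= mxrank_unit // unitmxE det_diag unitfE; apply/prodf_neq0 => i _.
by rewrite !mxE; case: (eqVneq (v 0 i) 0) => [->|v0]; rewrite ?add0r ?oner_eq0 // addr0.
Qed.

(** With [Z] the meet of [A] and [B], [meet] and [join] follow from the dimension formula for sums
    and intersections; adding them eliminates the ranks of [Z], [Z + C] and [Z + D]. *)
Lemma ingleton (F : fieldType) d (A B C D : 'M[F]_d) :
  (\rank A + \rank B + \rank (A + B + C)%MS + \rank (A + B + D)%MS + \rank (C + D)%MS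
   <= \rank (A + B)%MS + \rank (A + C)%MS + \rank (A + D)%MS
      + \rank (B + C)%MS + \rank (B + D)%MS)%N.
Proof.
pose Z := (A :&: B)%MS.
have meet (X : 'M[F]_d) :
    (\rank (A + B + X)%MS + \rank (Z + X)%MS <= \rank (A + X)%MS + \rank (B + X)%MS)%N.
  rewrite -(mxrank_sum_cap (A + X)%MS (B + X)%MS) leq_add // mxrankS //.
    by rewrite !addsmx_sub (submx_trans (addsmxSl A X) (addsmxSl _ _))
       (submx_trans (addsmxSl B X) (addsmxSr _ _)) (submx_trans (addsmxSr A X) (addsmxSl _ _)).
  by rewrite sub_capmx !addsmxS ?capmxSl ?capmxSr.
have join : (\rank (C + D)%MS + \rank Z <= \rank (Z + C)%MS + \rank (Z + D)%MS)%N.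
  rewrite -(mxrank_sum_cap (Z + C)%MS (Z + D)%MS) leq_add // mxrankS //.
    by rewrite addsmxS ?addsmxSr.
  by rewrite sub_capmx !addsmxSl.
have := mxrank_sum_cap A B; have := meet C; have := meet D; move: join; rewrite -/Z; lia.
Qed.

End Hermitian.

(** * Corank as an order of vanishing *)

Section Corank.

(** The Gram factor [F] of [B] normalizes [B] to the identity; then the Hermitian matrix [A] is
    diagonalized in the new coordinates. *)
Lemma simul_diag d (A B : 'M[RC]_d) : conjT A = A -> psd_hermitian B -> \det B != 0 ->
  exists (Q : 'M[RC]_d) (sp : 'rV[RC]_d),
    [/\ Q \in unitmx, A = conjT Q *m diag_mx sp *m Q & B = conjT Q *m Q].
Proof.
move=> hA /psd_gram[F BE] B0.
have uF : F \in unitmx.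
  by move: B0; rewrite BE det_mulmx mulf_eq0 negb_or unitmxE unitfE => /andP[].
have uF' : conjT F \in unitmx.
  by move: B0; rewrite BE det_mulmx mulf_eq0 negb_or unitmxE unitfE => /andP[].
have [|P [sp [PP AE]]] := @hermitian_diag _ (conjT (invmx F) *m A *m invmx F).
  by rewrite !conjTM conjTK hA mulmxA.
have cF : conjT F *m conjT (invmx F) = 1%:M.
  by rewrite -conjTM mulVmx // conjTE trmx1 map_mx1.
exists (P *m F), sp; split.
- by rewrite unitmx_mul uF andbT; case/mulmx1_unit: PP.
- rewrite conjTM !mulmxA -(mulmxA _ _ (diag_mx sp)) -(mulmxA _ _ P) -AE.
  by rewrite !mulmxA cF mul1mx mulmxKV.
- by rewrite conjTM -mulmxA (mulmxA (conjT P)) (mulmx1C PP) mul1mx.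
Qed.

Lemma poly_eq_nat (p q : {poly RC}) : (forall k : nat, p.[k%:R] = q.[k%:R]) -> p = q.
Proof.
move=> pq; apply/eqP; rewrite -subr_eq0; apply/eqP.
apply: (@roots_geq_poly_eq0 _ _ [seq k%:R | k <- iota 0 (size (p - q))]).
- by apply/allP => _ /mapP[k _ ->]; rewrite /root hornerD hornerN pq subrr.
- by rewrite map_inj_uniq ?iota_uniq // => i j /eqP; rewrite eqr_nat => /eqP.
- by rewrite size_map size_iota.
Qed.

Lemma Xn_mul_inj (F : fieldType) (m n : nat) (p q : {poly F}) :
  p.[0] != 0 -> q.[0] != 0 -> p * 'X^m = q * 'X^n -> m = n.
Proof.
wlog mn : m n p q / (m <= n)%N => [hw p0 q0 pq|p0 q0].
  by case/orP: (leq_total m n) => mn; [apply: (hw m n p q) | apply/esym/(hw n m q p)].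
rewrite -(subnK mn) exprD mulrA => /(mulIf (monic_neq0 (monicXn _ m))) pq.
case: (n - m)%N pq => [|k pq]; first by rewrite add0n.
by move: p0; rewrite pq hornerM hornerXn expr0n mulr0 eqxx.
Qed.

(* In the pencil [(1 - t) A + t B] the order of vanishing of the determinant at
   [t = 0] is the corank of [A], because [A] is diagonalizable with respect to [B]. *)
Lemma corank_pencil d (A B : 'M[RC]_d) (m : nat) (h : {poly RC}) :
  conjT A = A -> psd_hermitian B -> \det B != 0 -> h.[0] != 0 ->
  (forall k : nat, \det ((1 - k%:R) *: A + k%:R *: B) = h.[k%:R] * k%:R ^+ m) ->
  (\rank A + m)%N = d.
Proof.
move=> hA pB B0 h0 hdet; have [Q [sp [uQ AE BE]]] := simul_diag hA pB B0.
have uQ' : conjT Q \in unitmx.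
  by move: B0; rewrite BE det_mulmx mulf_eq0 negb_or unitmxE unitfE => /andP[].
have rA : \rank A = #|[pred i | sp 0%R i != 0%R]|.
  rewrite AE mxrankMfree ?row_free_unit // -mxrank_tr trmx_mul mxrankMfree; last first.
    by rewrite row_free_unit unitmx_tr.
  by rewrite tr_diag_mx mxrank_diag.
(* The diagonal entries of the pencil once [B] is the identity: [lin i] is ['X] for a zero
   eigenvalue and does not vanish at 0 otherwise. *)
pose lin i : {poly RC} := (sp 0 i)%:P * (1 - 'X) + 'X.
pose G := (\det (conjT Q) * \det Q)%:P * \prod_(i | sp 0 i != 0) lin i.
have GE : G * 'X^#|[predC [pred i | sp 0%R i != 0%R]]| = h * 'X^m.
  apply: poly_eq_nat => k; rewrite !hornerM !hornerXn -hdet.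
  have -> : (1 - k%:R) *: A + k%:R *: B =
      conjT Q *m diag_mx (\row_i (lin i).[k%:R]) *m Q.
    have -> : diag_mx (\row_i (lin i).[k%:R]) = (1 - k%:R) *: diag_mx sp + k%:R *: 1%:M.
      apply/matrixP => i j; rewrite !mxE /lin !hornerE.
      by case: (i == j); rewrite ?mulr1n ?mulr0n ?mulr0 ?addr0 ?mulr1 // mulrC.
    by rewrite mulmxDr mulmxDl -!scalemxAr -!scalemxAl mulmx1 -AE -BE.
  rewrite !det_mulmx det_diag hornerC horner_prod.
  rewrite [RHS](_ : _ = \det (conjT Q) * \det Q * \prod_(i < d) (lin i).[k%:R]); last first.
    by rewrite mulrAC; congr (_ * _); apply: eq_bigr => i _; rewrite mxE.
  rewrite -!mulrA; do 2![congr (_ * _)].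
  rewrite [RHS](bigID (fun i => sp 0 i != 0)) /=; congr (_ * _).
  rewrite -prodr_const; apply: eq_big => [i|i]; rewrite !inE // negbK => /eqP s0.
  by rewrite /lin s0 mul0r add0r hornerX.
have G0 : G.[0] != 0.
  rewrite hornerM hornerC mulf_neq0 //; first by rewrite mulf_neq0 // -unitfE -unitmxE.
  rewrite horner_prod; apply/prodf_neq0 => i s0.
  by rewrite /lin !hornerE subr0 mulr1.
by rewrite -(Xn_mul_inj G0 h0 GE) rA cardC card_ord.
Qed.
End Corank.

(** * The Ingleton obstruction *)

Section NoRepresentation.
Variables (d k : nat) (M : 'I_5 -> 'M[RC]_d).
Hypothesis psdM : forall j, psd_hermitian (M j).
Hypothesis detM : forall y : 'I_5 -> R,
  (V10_diag (y 0) (y 1) (y 2%:R) (y 3%:R) (y 4%:R))%:C ^+ k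
  = \det (\sum_j (y j)%:C *: M j).

Let B := \sum_j M j.

Lemma psd_sum (P : pred 'I_5) : psd_hermitian (\sum_(j | P j) M j).
Proof.
elim/big_ind: _ => [|X Y|j _]; [exact: psd0 | exact: psd_add | exact: psdM].
Qed.

Lemma det_total : \det B != 0.
Proof.
have := detM (fun=> 1); under eq_bigr do rewrite scale1r; rewrite -/B => <-.
rewrite expf_neq0 // eq_complex /= eqxx andbT /V10_diag /esym1 /esym2 /esym3.
by apply: lt0r_neq0; lra.
Qed.

(** With [y] equal to 1 on [P] and [t] elsewhere, the representation is the pencil from the sum over
    [P] to the total sum. The list [c] holds the coefficients of the cofactor of [t ^+ m], constant
    term first; as that term is nonzero, [m] is the exact order of vanishing. *)
Lemma rank_sum_pairs (P : pred 'I_5) (m : nat) (c : seq nat) : nth 0%N c 0 != 0%N ->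
  (forall t : R, let y j := if P j then 1 else t in
     V10_diag (y 0) (y 1) (y 2%:R) (y 3%:R) (y 4%:R)
     = (Poly [seq n%:R | n <- c]).[t] * t ^+ m) ->
  (\rank (\sum_(j | P j) M j)%R + m * k)%N = d.
Proof.
move=> c0 hP; pose h : {poly RC} := map_poly (real_complex R) (Poly [seq n%:R | n <- c]).
have [hA _] := psd_sum P.
apply: (corank_pencil (h := h ^+ k) hA (psd_sum predT) det_total).
  rewrite horner_exp expf_neq0 // -[0](rmorph0 (real_complex R)) horner_map horner_coef0 coef_Poly.
  rewrite fmorph_eq0; case: c c0 {hP h} => [|n c] //= n0.
  by rewrite pnatr_eq0.
move=> n; pose y j : R := if P j then 1 else n%:R.
have -> : (1 - n%:R) *: (\sum_(j | P j) M j) + n%:R *: (\sum_(j | predT j) M j)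
    = \sum_j (y j)%:C *: M j.
  rewrite !scaler_sumr big_mkcond -big_split /=; apply: eq_bigr => j _; rewrite /y.
  by case: (P j); rewrite ?scale1r ?add0r ?rmorph_nat // -scalerDl subrK scale1r.
rewrite -detM hP rmorphM rmorphXn rmorph_nat exprMn -exprM; congr (_ * _).
by rewrite horner_exp -(rmorph_nat (real_complex R)) horner_map.
Qed.

Let W (s : seq nat) := \sum_(j | val j \in s) M j.

Lemma adds_W (s t : seq nat) : ~~ has (mem t) s -> (W s + W t :=: W (s ++ t))%MS.
Proof.
move=> /hasPn st; have -> : W (s ++ t) = W s + W t.
  rewrite /W (bigID (fun j : 'I_5 => val j \in s)) /=.
  congr (_ + _); apply: eq_bigl => j; rewrite mem_cat; first by case: (_ \in s); rewrite ?andbF.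
  have [js|_] := boolP (val j \in s); rewrite ?andbT // andbF.
  by apply/esym/negbTE/(st _ js).
exact: psd_adds_sub (psd_sum _) (psd_sum _).
Qed.

Ltac expand_diag :=
  rewrite horner_Poly /= /V10_diag /esym1 /esym2 /esym3; ring.

(** The pairs 0, 1, 2, 3 form a Vámos configuration: of their six unions of two, only that of 1 and
    3 is a basis. In units of [k], the coranks in Ingleton's inequality sum to 2 + 2 + 0 + 0 + 0 on
    the left and to 1 + 1 + 1 + 1 + 1 on the right, so [5 k <= 4 k]. *)
Lemma trivial_power : k = 0%N.
Proof.
have r (s : seq nat) m c := @rank_sum_pairs (fun j => val j \in s) m c.
have := ingleton (W [:: 0%N]) (W [:: 2%N]) (W [:: 1%N]) (W [:: 3%N]).
have rank3 s t u : ~~ has (mem t) s -> ~~ has (mem u) (s ++ t) ->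
    \rank (W s + W t + W u)%MS = \rank (W ((s ++ t) ++ u)).
  by move=> st stu; rewrite (adds_eqmx (adds_W st) (eqmx_refl _)) adds_W.
rewrite !rank3 // !adds_W //=.
have r0 : (\rank (W [:: 0]%N) + 2 * k)%N = d.
  by apply: (r _ _ [:: 24; 112; 67]%N) => // t; expand_diag.
have r2 : (\rank (W [:: 2]%N) + 2 * k)%N = d.
  by apply: (r _ _ [:: 25; 112; 66]%N) => // t; expand_diag.
have r02 : (\rank (W [:: 0; 2]%N) + 1 * k)%N = d.
  by apply: (r _ _ [:: 24; 85; 80; 14]%N) => // t; expand_diag.
have r01 : (\rank (W [:: 0; 1]%N) + 1 * k)%N = d.
  by apply: (r _ _ [:: 24; 86; 80; 13]%N) => // t; expand_diag.
have r03 : (\rank (W [:: 0; 3]%N) + 1 * k)%N = d.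
  by apply: (r _ _ [:: 24; 85; 80; 14]%N) => // t; expand_diag.
have r21 : (\rank (W [:: 2; 1]%N) + 1 * k)%N = d.
  by apply: (r _ _ [:: 24; 87; 80; 12]%N) => // t; expand_diag.
have r23 : (\rank (W [:: 2; 3]%N) + 1 * k)%N = d.
  by apply: (r _ _ [:: 24; 86; 80; 13]%N) => // t; expand_diag.
have r021 : (\rank (W [:: 0; 2; 1]%N) + 0 * k)%N = d.
  by apply: (r _ _ [:: 12; 80; 87; 24]%N) => // t; expand_diag.
have r023 : (\rank (W [:: 0; 2; 3]%N) + 0 * k)%N = d.
  by apply: (r _ _ [:: 12; 80; 86; 24; 1]%N) => // t; expand_diag.
have r13 : (\rank (W [:: 1; 3]%N) + 0 * k)%N = d.
  by apply: (r _ _ [:: 1; 24; 85; 80; 13]%N) => // t; expand_diag.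
lia.
Qed.
End NoRepresentation.

Lemma V10_no_detrep (k : nat) : (0 < k)%N -> ~ has_definite_detrep V10_bases k.
Proof.
move=> k0 [d [A [psdA detA]]].
(* Identifying the two variables of a pair adds their matrices. *)
pose M (j : 'I_5) := A (e10 (val j).*2) + A (e10 (val j).*2.+1).
suff kE : k = 0%N by rewrite kE in k0.
apply: (@trivial_power d k M) => [j|y]; first exact: psd_add.
pose F n := (y (inord n./2))%:C *: A (e10 n).
have := detA (fun i => y (inord (val i)./2)).
have half (n : nat) (j : 'I_5) : (n < 10)%N -> n./2 = val j ->
    y (inord (val (e10 n))./2) = y j.
  by move=> n10 nj; rewrite /= inordK // nj inord_val.
rewrite bgp_V10E (half 0%N 0) // (half 1%N 0) // (half 2%N 1) // (half 3%N 1) //.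
rewrite (half 4%N 2%:R) // (half 5%N 2%:R) // (half 6%N 3%:R) // (half 7%N 3%:R) //.
rewrite (half 8%N 4%:R) // (half 9%N 4%:R) // V10_pair_diag -rmorph_V10_diag => ->.
rewrite (eq_bigr (fun i : 'I_10 => F (val i))); last by move=> i _; rewrite /F /e10 inord_val.
rewrite [in RHS](eq_bigr (fun j : 'I_5 => F (val j).*2 + F (val j).*2.+1)) => [|j _].
  by rewrite !big_ord_recl !big_ord0 /= !addrA.
by rewrite /F /M scalerDr doubleK /= uphalf_double inord_val.
Qed.

Theorem theorem1p1 :
  is_matroid_bases V10_bases /\
  half_plane_property V10_bases /\
  (forall k : nat, (0 < k)%N -> ~ has_definite_detrep V10_bases k).
Proof. exact: conj V10_matroid (conj V10_stable V10_no_detrep). Qed.
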